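(* Let $\varrho=|\psi\rangle\langle\psi|$ and $\tau=|\phi\rangle\langle\phi|$ be pure single-qubit states (with $|\psi\rangle,|\phi\rangle\in\mathbb{C}^2$ unit vectors). There exists a free operation $\Lambda$ such that $\Lambda(\varrho)=\tau$ if and only if $$\Sigma(\tau)\ge\Sigma(\varrho).$$
   Context: Let $\{|0\rangle,|1\rangle\}$ be the standard basis of $\mathbb{C}^2$, $|f_1\rangle=(|0\rangle+|1\rangle)/\sqrt2$ and $f_1=|f_1\rangle\langle f_1|$. A free operation is a completely positive trace-preserving linear map $\Lambda: M_2(\mathbb{C})\to M_2(\mathbb{C})$ with $\Lambda(f_1)=f_1$. The grand sum of a $2\times 2$ density matrix $\varrho$ is $\Sigma(\varrho)=\sum_{i,j}\varrho_{ij}=2\langle f_1|\varrho|f_1\rangle$, the sum of all its matrix entries in the standard basis. *)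

(* Defs.v *)
From mathcomp Require Import all_boot all_order all_algebra.
From mathcomp Require Import reals.
From mathcomp Require Import complex mxtens.

Set Implicit Arguments.
Unset Strict Implicit.
Unset Printing Implicit Defensive.

Import Order.TTheory GRing.Theory Num.Theory.
Local Open Scope ring_scope.
Local Open Scope sesquilinear_scope.

Section Quantum.

Variable C : numClosedFieldType.

Definition is_unit_vector n (v : 'cV[C]_n) : Prop :=
  \sum_i `|v i 0| ^+ 2 = 1.

(* |v><v| *)
Definition projector n (v : 'cV[C]_n) : 'M[C]_n := v *m v ^t*.

(* In C, 0 <= z means that z is real and nonnegative, so the condition forces
   A to be Hermitian. *)
Definition is_psd n (A : 'M[C]_n) : Prop :=
  forall v : 'cV[C]_n, 0 <= (v ^t* *m A *m v) 0 0.

(* The (i, j) block, of size n, of a k x k block matrix X, i.e. of an element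
   of M_k (x) M_n in the Kronecker indexing of mxtens. *)
Definition tens_block k n (X : 'M[C]_(k * n)) (i j : 'I_k) : 'M[C]_n :=
  \matrix_(a, b) X (mxtens_index (i, a)) (mxtens_index (j, b)).

(* id_k (x) L : M_k (x) M_n -> M_k (x) M_m *)
Definition ampliation k n m (L : 'M[C]_n -> 'M[C]_m)
    (X : 'M[C]_(k * n)) : 'M[C]_(k * m) :=
  \sum_i \sum_j delta_mx i j *t L (tens_block X i j).

Lemma ampliation_tens k n m (L : {linear 'M[C]_n -> 'M[C]_m})
    (A : 'M[C]_k) (B : 'M[C]_n) :
  ampliation L (A *t B) = A *t L B.
Proof.
apply/matrixP=> p q.
case: (mxtens_indexP p) => i a; case: (mxtens_indexP q) => j b.
have LE i' j' : L (tens_block (A *t B) i' j') = A i' j' *: L B.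
  rewrite -linearZ; congr (L _); apply/matrixP=> c d.
  by rewrite !mxE !mxtens_indexK.
rewrite /ampliation summxE (bigD1 i) //= summxE (bigD1 j) //= !big1 ?addr0.
- by rewrite LE !tensmxE !mxE !eqxx mul1r.
- move=> i' i'i; rewrite summxE big1 // => j' _.
  by rewrite tensmxE mxE eq_sym (negPf i'i) mul0r.
- by move=> j' j'j; rewrite tensmxE mxE (eq_sym j) (negPf j'j) andbF mul0r.
Qed.

Definition completely_positive n m (L : 'M[C]_n -> 'M[C]_m) : Prop :=
  forall (k : nat) (X : 'M[C]_(k * n)), is_psd X -> is_psd (ampliation L X).

Definition trace_preserving n m (L : 'M[C]_n -> 'M[C]_m) : Prop :=
  forall X : 'M[C]_n, \tr (L X) = \tr X.

Definition ket0 : 'cV[C]_2 := delta_mx 0 0.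
Definition ket1 : 'cV[C]_2 := delta_mx 1 0.
Definition ket_f1 : 'cV[C]_2 := (sqrtC 2)^-1 *: (ket0 + ket1).
Definition f1 : 'M[C]_2 := projector ket_f1.

Definition free_operation (L : {linear 'M[C]_2 -> 'M[C]_2}) : Prop :=
  [/\ completely_positive L, trace_preserving L & L f1 = f1].

Definition grand_sum (rho : 'M[C]_2) : C := \sum_i \sum_j rho i j.

Lemma grand_sumE (rho : 'M[C]_2) :
  grand_sum rho = 2 * (ket_f1 ^t* *m rho *m ket_f1) 0 0.
Proof.
have s2 : (sqrtC 2 : C)^-1 * (sqrtC 2)^-1 = 2^-1 by rewrite -invfM -expr2 sqrtCK.
have s2r : ((sqrtC 2 : C)^-1)^* = (sqrtC 2)^-1.
  by rewrite conj_Creal // rpredV ger0_real // sqrtC_ge0 ler0n.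
have fE i : ket_f1 i 0 = (sqrtC 2)^-1.
  by rewrite !mxE; case: i => [[|[|//]] ?] /=; rewrite ?addr0 ?add0r mulr1.
rewrite /grand_sum exchange_big mxE mulr_sumr; apply: eq_bigr => j _.
rewrite mxE fE mulr_suml mulr_sumr; apply: eq_bigr => i _.
by rewrite mxE mxE fE s2r mulrAC s2 mulrA divff ?mul1r ?pnatr_eq0.
Qed.

End Quantum.

(* Main.v *)
From HB Require Import structures.
Require Import Defs.
From mathcomp Require Import all_boot all_order all_algebra.
From mathcomp Require Import reals.
From mathcomp Require Import complex.
From mathcomp Require Import mxtens ring.

Set Implicit Arguments.
Unset Strict Implicit.
Unset Printing Implicit Defensive.

Import Order.TTheory GRing.Theory Num.Theory.
Local Open Scope ring_scope.

(* Let f2 be the unit vector orthogonal to f1, and write psi = a f1 + b f2 and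
   phi = c f1 + d f2, so that the grand sums are 2|a|^2 and 2|c|^2.

   If L is free, X |-> <f2|L X|f2> is nonnegative on projectors and vanishes on
   f1, so its off-diagonal part vanishes too and its value at |psi><psi| is |b|^2
   times its value at |f2><f2|, hence at most |b|^2; by trace preservation
   <f1|L(|psi><psi|)|f1> >= 1 - |b|^2 = |a|^2.

   Conversely, if b = 0 the identity works. Otherwise choose |x|^2 + |y|^2 = 1
   with x c = a; the Kraus operators |f1><f1| + (x d / b) |f2><f2| and
   (y / b) |phi><f2| send psi to x phi and y phi, and f1 to f1 and 0. *)

Section Channels.
Local Open Scope sesquilinear_scope.

Variable C : numClosedFieldType.

(** * Adjoints, positivity and tensor blocks *)

Lemma adjmxE m n (A : 'M[C]_(m, n)) i j : (A ^t* ) i j = (A j i)^*.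
Proof. by rewrite 2!mxE. Qed.

Lemma adjmxM m n p (A : 'M[C]_(m, n)) (B : 'M[C]_(n, p)) :
  (A *m B) ^t* = B ^t* *m A ^t*.
Proof. by rewrite trmx_mul map_mxM. Qed.

Lemma adjmxD m n (A B : 'M[C]_(m, n)) : (A + B) ^t* = A ^t* + B ^t*.
Proof. by rewrite linearD map_mxD. Qed.

Lemma adjmxZ m n a (A : 'M[C]_(m, n)) : (a *: A) ^t* = a^* *: A ^t*.
Proof. by rewrite linearZ map_mxZ. Qed.

Lemma adj_tensmx m n p q (A : 'M[C]_(m, n)) (B : 'M[C]_(p, q)) :
  (A *t B) ^t* = A ^t* *t B ^t*.
Proof. by rewrite trmx_tens map_mxT. Qed.

Lemma adjmx1 n : (1%:M : 'M[C]_n) ^t* = 1%:M.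
Proof. by rewrite trmx1 map_mx1. Qed.

(** The quadratic form at [v] is the squared norm of [A ^t* *m v]. *)
Lemma mulmx_adj_psd n p (A : 'M[C]_(n, p)) : is_psd (A *m A ^t*).
Proof.
move=> v; rewrite mulmxA -mulmxA -[v ^t* *m A]trmxCK adjmxM trmxCK mxE.
apply: sumr_ge0 => i _; rewrite adjmxE mulrC; exact: mul_conjC_ge0.
Qed.

(* Complete positivity is only used here, with a one-dimensional ancilla. *)
Lemma cp_projector_ge0 m n (L : {linear 'M[C]_n -> 'M[C]_m}) (u : 'cV[C]_n)
    (w : 'cV[C]_m) :
  completely_positive L -> 0 <= (w ^t* *m L (projector u) *m w) 0 0.
Proof.
move=> cpL.
(* Tensoring with the 1 x 1 identity moves [u] and [w] to the sizes [1 * n] and [1 * m] at which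
   [ampliation] acts. *)
pose U : 'M[C]_(1 * n, 1 * 1) := 1%:M *t u.
pose W : 'M[C]_(1 * m, 1 * 1) := 1%:M *t w.
have XE : U *m U ^t* = 1%:M *t projector u.
  by rewrite adj_tensmx adjmx1 tensmx_mul mulmx1.
have WE : W ^t* *m (1%:M *t L (projector u)) *m W
    = 1%:M *t (w ^t* *m L (projector u) *m w).
  by rewrite adj_tensmx adjmx1 !tensmx_mul !mulmx1.
have := cpL 1%N _ (mulmx_adj_psd U) W; rewrite XE ampliation_tens.
congr (0 <= _); rewrite (congr1 (fun M : 'M_(1 * 1) => M 0 0) WE).
by rewrite mxE !ord1 mxE mul1r.
Qed.

(** Reduces questions about ampliations to pure tensors; read backwards, it says that ampliating the
    identity gives the identity. *)
Lemma tens_blockK k n (X : 'M[C]_(k * n)) :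
  X = \sum_i \sum_j delta_mx i j *t tens_block X i j.
Proof.
apply/matrixP=> p q.
case: (mxtens_indexP p) => i a; case: (mxtens_indexP q) => j b.
rewrite summxE (bigD1 i) //= summxE (bigD1 j) //= !big1 ?addr0.
- by rewrite !tensmxE !mxE !eqxx mul1r.
- move=> i' i'i; rewrite summxE big1 // => j' _.
  by rewrite tensmxE mxE eq_sym (negPf i'i) mul0r.
- by move=> j' j'j; rewrite tensmxE mxE (eq_sym j) (negPf j'j) andbF mul0r.
Qed.

(** * Kraus maps *)

Section Kraus.
Variables (I : finType) (m n : nat) (K : I -> 'M[C]_(m, n)).

Definition kraus (X : 'M[C]_n) : 'M[C]_m := \sum_i K i *m X *m (K i) ^t*.

Fact kraus_is_linear : linear kraus.
Proof.
move=> a X Y; rewrite /kraus scaler_sumr -big_split; apply: eq_bigr => i _ /=.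
by rewrite mulmxDr mulmxDl -scalemxAr -scalemxAl.
Qed.
HB.instance Definition _ :=
  GRing.isLinear.Build C 'M[C]_n 'M[C]_m *:%R kraus kraus_is_linear.

(** On a pure tensor, conjugation by [1%:M *t K i] acts on the second factor alone. An ampliated
    Kraus map is thus again a Kraus map, and complete positivity reduces to positivity. *)
Lemma ampliation_kraus k (X : 'M[C]_(k * n)) :
  ampliation kraus X =
  \sum_i (1%:M *t K i) *m X *m (1%:M *t K i) ^t* :> 'M[C]_(k * m).
Proof.
have tensD (A : 'M[C]_k) :
  {morph tensmx A : x y / x + y >-> x + y :> 'M[C]_(k * m)}.
  by move=> B B'; apply/matrixP => p q; rewrite !mxE mulrDr.
under [RHS]eq_bigr => i _.
  rewrite {1}[X]tens_blockK mulmx_sumr mulmx_suml.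
  under eq_bigr => a _ do rewrite mulmx_sumr mulmx_suml.
  over.
rewrite exchange_big; apply: eq_bigr => a _; rewrite exchange_big.
apply: eq_bigr => b _.
rewrite (big_morph _ (tensD _) (tensmx0 _)); apply: eq_bigr => i _.
by rewrite adj_tensmx adjmx1 !tensmx_mul mul1mx mulmx1.
Qed.

Lemma kraus_cp : completely_positive kraus.
Proof.
move=> k X psdX v; rewrite ampliation_kraus mulmx_sumr mulmx_suml summxE.
apply: sumr_ge0 => i _; set A := 1%:M *t K i.
(* Testing [A *m X *m A ^t*] on [v] is testing [X] on [A ^t* *m v]. *)
by have := psdX (A ^t* *m v); rewrite adjmxM trmxCK !mulmxA.
Qed.

Lemma kraus_tp :
  \sum_i (K i) ^t* *m K i = 1%:M -> trace_preserving kraus.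
Proof.
move=> K1 X; rewrite /kraus raddf_sum /=.
under eq_bigr do rewrite mxtrace_mulC mulmxA.
by rewrite -raddf_sum -mulmx_suml K1 mul1mx.
Qed.

End Kraus.

End Channels.

Section Qubit.
Local Open Scope sesquilinear_scope.

Variable C : numClosedFieldType.

Lemma projectorD n (x y : C) (u v : 'cV[C]_n) :
  projector (x *: u + y *: v) =
  (x * x^* ) *: projector u + (x * y^* ) *: (u *m v ^t*)
  + ((x^* * y) *: (v *m u ^t*) + (y * y^* ) *: projector v).
Proof.
rewrite /projector adjmxD !adjmxZ mulmxDl !mulmxDr.
rewrite -!scalemxAr -!scalemxAl !scalerA.
by rewrite (mulrC _ x^* ) [y^* * x]mulrC [y^* * y]mulrC.
Qed.

Lemma orthonormal_norm (x y : C) n (u v : 'cV[C]_n) :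
  u ^t* *m u = 1%:M -> v ^t* *m v = 1%:M ->
  u ^t* *m v = 0 -> v ^t* *m u = 0 ->
  (x *: u + y *: v) ^t* *m (x *: u + y *: v) = (x * x^* + y * y^*)%:M.
Proof.
move=> uu vv uv vu; rewrite adjmxD !adjmxZ mulmxDl !mulmxDr.
rewrite -!scalemxAr -!scalemxAl uu vv uv vu !scaler0 addr0 add0r.
by rewrite !scalerA -scalerDl scalemx1.
Qed.

(** * The orthonormal basis f1, f2 and coordinates of a qubit *)

Definition ket_f2 : 'cV[C]_2 := (sqrtC 2)^-1 *: (ket0 C - ket1 C).

Local Notation f := (ket_f1 C).
Local Notation g := ket_f2.

Lemma sqrt2V_conj : ((sqrtC 2 : C)^-1)^* = (sqrtC 2)^-1.
Proof. by rewrite conj_Creal // rpredV ger0_real // sqrtC_ge0 ler0n. Qed.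

Lemma sqrt2V_sqr : (sqrtC 2 : C)^-1 * (sqrtC 2)^-1 = 2^-1.
Proof. by rewrite -invfM -expr2 sqrtCK. Qed.

Lemma half_add : 2^-1 + 2^-1 = 1 :> C.
Proof. by rewrite [RHS]splitr mul1r. Qed.

Lemma ket_f1E i : f i 0 = (sqrtC 2)^-1.
Proof. by rewrite !mxE; case: i => [[|[|//]] ?] /=; rewrite ?addr0 ?add0r mulr1. Qed.

Lemma ket_f2E i : g i 0 = (-1) ^+ i * (sqrtC 2)^-1.
Proof.
rewrite !mxE; case: i => [[|[|//]] ?] /=.
  by rewrite subr0 mulr1 expr0 mul1r.
by rewrite sub0r mulrN1 expr1 mulN1r.
Qed.

Lemma ket_f1_norm : f ^t* *m f = 1%:M.
Proof.
apply/matrixP => i j; rewrite !ord1 mxE !big_ord_recl big_ord0 addr0.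
by rewrite !adjmxE !ket_f1E sqrt2V_conj sqrt2V_sqr half_add mxE.
Qed.

Lemma ket_f2_norm : g ^t* *m g = 1%:M.
Proof.
apply/matrixP => i j; rewrite !ord1 mxE !big_ord_recl big_ord0 addr0.
rewrite !adjmxE !ket_f2E /= expr0 expr1 mul1r mulN1r rmorphN mulrNN /=.
by rewrite sqrt2V_conj sqrt2V_sqr half_add mxE.
Qed.

Lemma ket_f1_f2 : f ^t* *m g = 0.
Proof.
apply/matrixP => i j; rewrite !ord1 mxE !big_ord_recl big_ord0 addr0.
rewrite !adjmxE !ket_f1E !ket_f2E /= expr0 expr1 mul1r mulN1r mulrN.
by rewrite subrr mxE.
Qed.

Lemma ket_f2_f1 : g ^t* *m f = 0.
Proof. by rewrite -[LHS]trmxCK adjmxM trmxCK ket_f1_f2 trmx0 map_mx0. Qed.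

Lemma projector_f1_f2 : projector f + projector g = 1%:M.
Proof.
apply/matrixP => i j; rewrite mxE 2![in LHS]mxE !big_ord1 !adjmxE !ket_f1E !ket_f2E.
rewrite rmorphM /= rmorphXn rmorphN1 /= sqrt2V_conj mulrACA sqrt2V_sqr.
by rewrite -exprD mxE; case: i j => [[|[|//]] ?] [[|[|//]] ?] /=;
  rewrite ?expr0 ?expr1 ?expr2 ?mulrNN ?mulN1r ?mul1r ?subrr ?half_add.
Qed.

Lemma mxtrace_f1_f2 (X : 'M[C]_2) :
  \tr X = (f ^t* *m X *m f) 0 0 + (g ^t* *m X *m g) 0 0.
Proof.
rewrite -[X in LHS]mulmx1 -projector_f1_f2 mulmxDr linearD /=.
by rewrite /projector !mulmxA !(mxtrace_mulC (_ *m _) (_ ^t*)) !mulmxA !trace_mx11.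
Qed.

Lemma qubitP (u : 'cV[C]_2) : is_unit_vector u ->
  exists a b : C, [/\ u = a *: f + b *: g, a * a^* + b * b^* = 1
    & grand_sum (projector u) = 2 * (a * a^* )].
Proof.
move=> uu; pose a := (f ^t* *m u) 0 0; pose b := (g ^t* *m u) 0 0.
have uE : u = a *: f + b *: g.
  rewrite -[LHS]mul1mx -projector_f1_f2 mulmxDl /projector -!mulmxA.
  by rewrite [f ^t* *m _]mx11_scalar [g ^t* *m _]mx11_scalar !mul_mx_scalar.
have sand (w : 'cV[C]_2) : (w ^t* *m projector u *m w) 0 0
    = (w ^t* *m u) 0 0 * ((w ^t* *m u) 0 0)^*.
  rewrite /projector !mulmxA -mulmxA -{2}[w]trmxCK -adjmxM.
  by rewrite mxE big_ord1 adjmxE.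
exists a, b; split=> //; last by rewrite grand_sumE sand.
(* Both sides are the trace of [projector u]: one in the basis f1, f2, the other in the standard
   basis. *)
rewrite -!sand -mxtrace_f1_f2 mxtrace_mulC trace_mx11 mxE -uu.
by apply: eq_bigr => i _; rewrite adjmxE normCK mulrC.
Qed.

(** * Necessity: the overlap with f1 cannot decrease *)

Lemma free_operation_fidelity (L : {linear 'M[C]_2 -> 'M[C]_2}) a b :
  free_operation L -> a * a^* + b * b^* = 1 ->
  a * a^* <= (f ^t* *m L (projector (a *: f + b *: g)) *m f) 0 0.
Proof.
move=> [cpL tpL fL] ab1.
pose h X := (g ^t* *m L X *m g) 0 0.
have hD X Y : h (X + Y) = h X + h Y.
  by rewrite /h linearD mulmxDr mulmxDl mxE.
have hZ c X : h (c *: X) = c * h X.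
  by rewrite /h [L (c *: X)]linearZ /= -(scalemxAr c) -(scalemxAl c) mxE.
have h_ge0 u : 0 <= h (projector u) by apply: cp_projector_ge0.
have hf : h (projector f) = 0.
  by rewrite /h fL /f1 /projector mulmxA ket_f2_f1 !mul0mx mxE.
have hE x y : h (projector (x *: f + y *: g)) =
    x * y^* * h (f *m g ^t*) + x^* * y * h (g *m f ^t*)
    + y * y^* * h (projector g).
  by rewrite projectorD !hD !hZ hf mulr0 add0r addrA.
have tr1 u : u ^t* *m u = 1%:M ->
    (f ^t* *m L (projector u) *m f) 0 0 = 1 - h (projector u).
  move=> uu; apply/eqP; rewrite eq_sym subr_eq -mxtrace_f1_f2 tpL mxtrace_mulC.
  by rewrite uu mxtrace1.
have hg : h (projector g) <= 1.
  by rewrite -subr_ge0 -tr1 ?ket_f2_norm //; apply: cp_projector_ge0.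
pose c := a * b^* * h (f *m g ^t*) + a^* * b * h (g *m f ^t*).
pose z := b * b^* * h (projector g).
have z_ge0 : 0 <= z by rewrite mulr_ge0 ?mul_conjC_ge0.
(* The term [c] is the off-diagonal contribution. It is real, being the difference of the
   nonnegative [h (projector (a *: f + b *: g))] and [z]. Since [hE] has no [x * x^*] term, scaling
   [a] by a real factor changes [h] affinely with slope [c], so positivity excludes a nonzero
   slope. *)
have c0 : c = 0.
  have c_real : c \is Num.real.
    rewrite -[c](addrK z) -hE; apply: rpredB; apply: ger0_real => //.
  apply/eqP; apply: contraT => c_neq0.
  (* The form is t c + z at (t a, b) for real t; this t makes it equal to -1. *)
  pose t := - (z + 1) / c.
  have t_real : t^* = t.
    apply: conj_Creal; rewrite rpred_div // rpredN rpredD ?rpred1 //.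
    exact: ger0_real.
  have := h_ge0 ((t * a) *: f + b *: g); rewrite hE rmorphM /= t_real -/z.
  have -> : t * a * b^* * h (f *m g ^t*) + t * a^* * b * h (g *m f ^t*) = t * c.
    by rewrite mulrDr !mulrA.
  rewrite divfK //.
  by rewrite opprD addrAC addNr add0r oppr_ge0 ler10.
have uu : (a *: f + b *: g) ^t* *m (a *: f + b *: g) = 1%:M.
  by rewrite orthonormal_norm ?ab1 ?ket_f1_norm ?ket_f2_norm ?ket_f1_f2
    ?ket_f2_f1.
rewrite tr1 // hE -/c -/z c0 add0r lerBrDr -ab1 lerD2l /z.
by rewrite ler_piMr ?mul_conjC_ge0.
Qed.

(** * Sufficiency: an explicit channel *)

Lemma projectorZ n (x : C) (u : 'cV[C]_n) :
  projector (x *: u) = (x * x^*) *: projector u.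
Proof. by rewrite /projector adjmxZ -scalemxAl -scalemxAr scalerA. Qed.

Lemma kraus_projector (I : finType) m n (K : I -> 'M[C]_(m, n)) (u : 'cV[C]_n) :
  kraus K (projector u) = \sum_i projector (K i *m u).
Proof. by apply: eq_bigr => i _; rewrite /projector adjmxM !mulmxA. Qed.

Lemma projector_adj n (u : 'cV[C]_n) : (projector u) ^t* = projector u.
Proof. by rewrite /projector adjmxM trmxCK. Qed.

Lemma id_cp n : completely_positive (@idfun 'M[C]_n).
Proof. by move=> k X; rewrite /ampliation /= -tens_blockK. Qed.

(* If c = 0 then a = 0 too, and x = a / c = 0 by the convention on division. *)
Lemma exists_contraction (a c : C) : a * a^* <= c * c^* ->
  exists x y : C, x * c = a /\ x * x^* + y * y^* = 1.
Proof.
move=> le_ac; exists (a / c); exists (sqrtC (1 - a / c * (a / c)^*)); split.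
  have [c0|c0] := eqVneq c 0; last by rewrite divfK.
  move: le_ac; rewrite c0 invr0 !mulr0 mul0r => /le_gtF/negbT.
  by rewrite mul_conjC_gt0 negbK eq_sym => /eqP.
have le1 : a / c * (a / c)^* <= 1.
  have [->|c0] := eqVneq c 0; first by rewrite invr0 mulr0 mul0r ler01.
  rewrite rmorphM /= fmorphV mulrACA -invfM.
  by rewrite ler_pdivrMr ?mul_conjC_gt0 // mul1r.
(* The chosen [y] is the square root of a nonnegative number, hence real, so [y * y^*] is its
   square. *)
have /ger0_real/conj_Creal -> : 0 <= sqrtC (1 - a / c * (a / c)^*).
  by rewrite sqrtC_ge0 subr_ge0.
by rewrite -expr2 sqrtCK addrC subrK.
Qed.

Lemma exists_free_operation (a b c d : C) :
  a * a^* + b * b^* = 1 -> c * c^* + d * d^* = 1 -> a * a^* <= c * c^* ->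
  exists L : {linear 'M[C]_2 -> 'M[C]_2}, free_operation L
    /\ L (projector (a *: f + b *: g)) = projector (c *: f + d *: g).
Proof.
move=> ab1 cd1 le_ac; have [b0|b0] := eqVneq b 0.
  rewrite b0 mul0r addr0 in ab1.
  (* Here [a] has modulus 1, which leaves no room for [d]; both states are then f1 up to a phase. *)
  have d0 : d = 0.
    apply/eqP; move: le_ac; rewrite ab1 -cd1 gerDl => /le_gtF/negbT.
    by rewrite mul_conjC_gt0 negbK.
  rewrite d0 mul0r addr0 in cd1.
  exists idfun; split; first by split=> //; exact: id_cp.
  by rewrite b0 d0 !scale0r !addr0 !projectorZ ab1 cd1.
have [x [y [xc xy1]]] := exists_contraction le_ac.
pose phi := c *: f + d *: g.
have phi1 : phi ^t* *m phi = 1%:M.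
  by rewrite orthonormal_norm ?cd1 ?ket_f1_norm ?ket_f2_norm ?ket_f1_f2
    ?ket_f2_f1.
pose s := x * d / b; pose r := y / b.
pose K i := if i then projector f + s *: projector g else r *: (phi *m g ^t*).
have KtE u v : K true *m (u *: f + v *: g) = u *: f + (s * v) *: g.
  rewrite mulmxDl !mulmxDr -!(scalemxAr u) -!(scalemxAr v) -!(scalemxAl s).
  rewrite /projector -!mulmxA.
  rewrite ket_f1_norm ket_f2_norm ket_f1_f2 ket_f2_f1 !mulmx0 !mulmx1.
  by rewrite !scaler0 addr0 add0r (scalerA v) mulrC.
have KfE u v : K false *m (u *: f + v *: g) = (r * v) *: phi.
  rewrite !mulmxDr -(scalemxAr u) -(scalemxAr v) -!(scalemxAl r) -!mulmxA.
  rewrite ket_f2_norm ket_f2_f1 mulmx0 mulmx1.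
  by rewrite !scaler0 add0r scalerA mulrC.
exists (kraus K); split; last first.
  rewrite [LHS]kraus_projector big_bool KtE KfE /s /r !divfK //.
  rewrite -xc -!scalerA -scalerDr.
  by rewrite !projectorZ /= -scalerDl xy1 scale1r.
split; first exact: kraus_cp.
  apply: kraus_tp; rewrite big_bool /=.
  have proj_mul (u v : 'cV[C]_2) : projector u *m projector v
      = u *m (u ^t* *m v) *m v ^t* by rewrite /projector !mulmxA.
  (* As [phi] is a unit vector, it drops out of the completeness relation. *)
  have phi_g : (phi *m g ^t*) ^t* *m (phi *m g ^t*) = projector g.
    by rewrite adjmxM trmxCK mulmxA -(mulmxA g) phi1 mulmx1.
  rewrite adjmxD (adjmxZ s) (adjmxZ r) !projector_adj mulmxDl !mulmxDr.
  rewrite -!(scalemxAr s) -!(scalemxAl s^*) -(scalemxAr r) -(scalemxAl r^*).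
  rewrite phi_g !proj_mul.
  rewrite ket_f1_norm ket_f2_norm ket_f1_f2 ket_f2_f1 !mulmx0 !mul0mx !mulmx1.
  rewrite -/(projector f) -/(projector g).
  rewrite !scaler0 addr0 add0r !scalerA -addrA -scalerDl.
  (* Only the coefficient of [projector g] remains to be checked. After clearing [b * b^*], it is
     the identity |x|^2 (1 - |c|^2) + 1 - |x|^2 = 1 - |x|^2 |c|^2. *)
  suff -> : s * s^* + r * r^* = 1 by rewrite scale1r projector_f1_f2.
  rewrite /s /r !rmorphM /= !fmorphV mulrACA -invfM (mulrACA y) -invfM -mulrDl.
  apply: (canLR (mulfK _)); first by rewrite mulf_neq0 ?conjC_eq0.
  have -> : b * b^* = 1 - x * c * (x^* * c^*)
    by rewrite -rmorphM xc -ab1 addrC addKr.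
  have -> : y * y^* = 1 - x * x^* by rewrite -xy1 addrC addKr.
  rewrite mulrACA; have -> : d * d^* = 1 - c * c^* by rewrite -cd1 addrC addKr.
  ring.
have f1E : f1 C = projector (1 *: f + 0 *: g) by rewrite scale1r scale0r addr0.
rewrite {1}f1E [LHS]kraus_projector big_bool /= KtE KfE !mulr0 -f1E.
by rewrite projectorZ mul0r scale0r addr0.
Qed.


(** The argument works over any [numClosedFieldType]; the complex case is an instance. *)
Lemma pure_free_conversion (psi phi : 'cV[C]_2) :
  is_unit_vector psi -> is_unit_vector phi ->
  (exists L : {linear 'M[C]_2 -> 'M[C]_2},
     free_operation L /\ L (projector psi) = projector phi)
  <-> grand_sum (projector psi) <= grand_sum (projector phi).
Proof.
move=> /qubitP[a [b [psiE ab1 ->]]] phi_unit.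
have [c [d [phiE cd1 gs_phi]]] := qubitP phi_unit.
split=> [[L [freeL LE]]|].
  have := free_operation_fidelity freeL ab1; rewrite -psiE LE => le_a.
  (* The grand sum of the target is kept as an expectation value in f1, the form in which the
     fidelity bound delivers it. *)
  by rewrite grand_sumE ler_pM2l ?ltr0n.
rewrite gs_phi ler_pM2l ?ltr0n // psiE phiE; exact: exists_free_operation.
Qed.

End Qubit.

Local Open Scope complex_scope.

Theorem proposition1 (R : realType) (psi phi : 'cV[R[i]]_2)
    (psi_unit : is_unit_vector psi) (phi_unit : is_unit_vector phi) :
  (exists L : {linear 'M[R[i]]_2 -> 'M[R[i]]_2},
     free_operation L /\ L (projector psi) = projector phi)
  <-> grand_sum (projector psi) <= grand_sum (projector phi).
Proof. exact: pure_free_conversion. Qed.
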